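(* For every integer $q\ge 16$, with $K=q^2$, there exists a problem instance, namely the two-block convex problem $\mathcal P_K$ in $\mathcal H=\mathbb R^2\times\mathbb R$ defined in the context, such that the last iterate $w^K$ and the equal-weight ergodic average $w_a^K:=K^{-1}\sum_{j=1}^K w^j$ generated by ADMM with $\sigma=\tau=1$ on $\mathcal P_K$ from the initial point $w^0$ (iteration and initial point as defined in the context) satisfy $$\|\mathcal R_K(w^K)\|\ \ge\ \frac{R_0}{4\sqrt{2K}},\qquad \|\mathcal R_K(w_a^K)\|\ \ge\ \frac{R_0}{8\sqrt{2K}},$$ where $\mathcal R_K$ is the KKT residual mapping of $\mathcal P_K$ and $R_0=\|w^0-w^\star\|$ is the distance from $w^0$ to the unique KKT point $w^\star=(0,0,0)$ of $\mathcal P_K$. Consequently, neither output admits a uniform $O(R_0/K)$ worst-case bound over this problem family: there is no constant $C>0$ independent of $K$ such that $\|\mathcal R_K(w^K)\|\le C R_0/K$ for all $K=q^2$ with integer $q\ge16$, and there is no constant $C>0$ independent of $K$ such that $\|\mathcal R_K(w_a^K)\|\le C R_0/K$ for all $K=q^2$ with integer $q\ge 16$.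
   Context: All norms are Euclidean, $\delta_C$ denotes the indicator function of a closed convex set $C$ ($0$ on $C$, $+\infty$ off $C$), and $\operatorname{prox}_h(u)=\operatorname{argmin}_v\{h(v)+\tfrac12\|v-u\|^2\}$ for a proper closed convex function $h$. Fix an integer $q\ge16$ and set $K:=q^2$, $A_0:=1/\sqrt2$. Let $\mathcal H:=\mathbb R^2\times\mathbb R$ and write $y=(y_{\rm s},y_{\rm n})$, $z=(z_{\rm s},z_{\rm n})$, $x=(x_{\rm s},x_{\rm n})$ for elements of $\mathcal H$, with the ${\rm s}$-part in $\mathbb R^2$ and the ${\rm n}$-part in $\mathbb R$. Let $e_1=(1,0)^\top$, $\theta_K:=1/q$, $$U:=\operatorname{span}(e_1)\subset\mathbb R^2,\qquad V_K:=\operatorname{span}\big((\cos\theta_K,\sin\theta_K)^\top\big)\subset\mathbb R^2,$$ $$\phi_K(t):=\mu_K\sqrt{t^2+\varepsilon_K^2}\ \ (t\in\mathbb R),\qquad \mu_K:=\frac{A_0}{4q},\qquad \varepsilon_K:=\frac{\mu_K}{10},$$ $$f_K(y):=\delta_U(y_{\rm s}),\qquad g_K(z):=\delta_{V_K}(z_{\rm s})+\phi_K(z_{\rm n}).$$ The problem $\mathcal P_K$ is $$\min_{y,z\in\mathcal H}\{f_K(y)+g_K(z)\ :\ y-z=0\}.$$ Its KKT conditions for $w=(y,z,x)\in\mathcal H^3$ are $0\in\partial f_K(y)+x$, $0\in\partial g_K(z)-x$, $y-z=0$; the unique KKT point is $w^\star=(0,0,0)$. Its KKT residual mapping is $$\mathcal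 R_K(y,z,x):=\begin{pmatrix} y-\operatorname{prox}_{f_K}(y-x)\\ z-\operatorname{prox}_{g_K}(z+x)\\ z-y\end{pmatrix}.$$ The augmented Lagrangian with penalty parameter $\sigma=1$ is $$\mathcal L_{1,K}(y,z;x):=f_K(y)+g_K(z)+\langle x,y-z\rangle+\tfrac12\|y-z\|^2.$$ ADMM (penalty $\sigma=1$, step length $\tau=1$, update order $z\to x\to y$) starts from $w^0=(y^0,z^0,x^0)$ with $$y_{\rm s}^0=z_{\rm s}^0=0,\quad x_{\rm s}^0=A_0e_1,\quad y_{\rm n}^0=A_0,\quad z_{\rm n}^0=x_{\rm n}^0=0,$$ and for $k=0,\dots,K-1$ computes $$z^{k+1}=\operatorname*{argmin}_{z\in\mathcal H}\mathcal L_{1,K}(y^k,z;x^k),\qquad x^{k+1}=x^k+y^k-z^{k+1},\qquad y^{k+1}=\operatorname*{argmin}_{y\in\mathcal H}\mathcal L_{1,K}(y,z^{k+1};x^{k+1}),$$ and sets $w^{k+1}=(y^{k+1},z^{k+1},x^{k+1})$. Its two outputs are $w^K$ and $w_a^K=\frac1K\sum_{j=1}^Kw^j$. The initial distance is $R_0:=\|w^0-w^\star\|=\sqrt2A_0=1$. *)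

(* Defs.v *)
(* MathComp and MathComp-Analysis, over an arbitrary realType. *)
From mathcomp Require Import all_boot all_order all_algebra.
From mathcomp Require Import all_classical all_reals all_analysis.

Set Implicit Arguments.
Unset Strict Implicit.
Unset Printing Implicit Defensive.

Import Order.TTheory GRing.Theory Num.Theory.
Local Open Scope classical_set_scope.
Local Open Scope ring_scope.

(* R^2 x R, with the s-part first and the n-part second; R^o is R seen as a
   vector space over itself. *)
Notation spaceH R := ('rV[R]_2 * R^o)%type.
(* Triples w = (y, z, x), i.e. ((y, z), x). *)
Notation spaceW R := (spaceH R * spaceH R * spaceH R)%type.

(* The library norm `|.| on these types is the sup norm, so the Euclidean inner
   product and norms are introduced explicitly. *)
Definition dotH (R : realType) (u v : spaceH R) : R :=
  (\sum_(i < 2) u.1 0 i * v.1 0 i) + u.2 * v.2.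

Definition normH (R : realType) (u : spaceH R) : R := Num.sqrt (dotH u u).

Definition normW (R : realType) (w : spaceW R) : R :=
  Num.sqrt (normH w.1.1 ^+ 2 + normH w.1.2 ^+ 2 + normH w.2 ^+ 2).

Definition argmin_set (R : realType) (T : Type) (F : T -> \bar R) : set T :=
  [set v | forall u, (F v <= F u)%E].

(* The value 0 is only a default for functions without minimizer; every
   objective arising for the concrete f, g and w0 has exactly one. *)
Definition argmin (R : realType) (F : spaceH R -> \bar R) : spaceH R :=
  xget 0 (argmin_set F).

Definition prox (R : realType) (h : spaceH R -> \bar R) (u : spaceH R) :
    spaceH R :=
  argmin (fun v => h v + (2^-1 * normH (v - u) ^+ 2)%:E)%E.

(* For a proper h, the inequality has no solution v when h u = +oo. *)
Definition subdiff (R : realType) (h : spaceH R -> \bar R) (u : spaceH R) :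
    set (spaceH R) :=
  [set v | forall u', (h u + (dotH v (u' - u))%:E <= h u')%E].

Section TwoBlock.
Context (R : realType).
Implicit Types (f g : spaceH R -> \bar R) (w : spaceW R).

(* KKT conditions of min { f y + g z : y - z = 0 }. *)
Definition is_KKT f g w : Prop :=
  let: (y, z, x) := w in
  [/\ [set v + x | v in subdiff f y] 0,
      [set v - x | v in subdiff g z] 0
    & y - z = 0].

Definition KKT_residual f g w : spaceW R :=
  let: (y, z, x) := w in
  (y - prox f (y - x), z - prox g (z + x), z - y).

(* Penalty parameter 1. *)
Definition aug_lagrangian f g (y z x : spaceH R) : \bar R :=
  (f y + g z + (dotH x (y - z) + 2^-1 * normH (y - z) ^+ 2)%:E)%E.

(* Penalty parameter and step length 1, update order z, x, y. *)
Definition ADMM_step f g w : spaceW R :=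
  let: (y, z, x) := w in
  let z' := argmin (fun v => aug_lagrangian f g y v x) in
  let x' := x + y - z' in
  let y' := argmin (fun v => aug_lagrangian f g v z' x') in
  (y', z', x').

Definition ADMM f g w0 (k : nat) : spaceW R := iter k (ADMM_step f g) w0.

Definition ergodic_average (w : nat -> spaceW R) (K : nat) : spaceW R :=
  K%:R^-1 *: \sum_(1 <= j < K.+1) w j.

End TwoBlock.

Section Instance.
Context (R : realType).

Definition indicator (V : lmodType R) (C : {pred V}) (v : V) : \bar R :=
  if v \in C then 0%E else +oo%E.

Definition A0 : R := (Num.sqrt 2)^-1.

Definition vec2 (a b : R) : 'rV[R]_2 := \row_(i < 2) (if i == 0 then a else b).

Definition e1 : 'rV[R]_2 := vec2 1 0.

(* The parameter q determines K = q ^ 2. *)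
Definition theta (q : nat) : R := q%:R^-1.

Definition U : {vspace 'rV[R]_2} := <[e1]>%VS.

Definition V (q : nat) : {vspace 'rV[R]_2} :=
  <[vec2 (cos (theta q)) (sin (theta q))]>%VS.

Definition mu (q : nat) : R := A0 / (4 * q%:R).

Definition eps (q : nat) : R := mu q / 10.

Definition phi (q : nat) (t : R) : R :=
  mu q * Num.sqrt (t ^+ 2 + eps q ^+ 2).

(* f does not depend on q. *)
Definition f (y : spaceH R) : \bar R := indicator (mem U) y.1.

Definition g (q : nat) (z : spaceH R) : \bar R :=
  (indicator (mem (V q)) z.1 + (phi q z.2)%:E)%E.

Definition w0 : spaceW R := ((0, A0), (0, 0), (A0 *: e1, 0)).

Definition wstar : spaceW R := 0.

Definition R0 : R := normW (w0 - wstar).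

Definition residual (q : nat) (w : spaceW R) : spaceW R :=
  KKT_residual f (g q) w.

Definition iterate (q : nat) (k : nat) : spaceW R := ADMM f (g q) w0 k.

Definition last_iterate (q : nat) : spaceW R := iterate q (q ^ 2)%N.

Definition average (q : nat) : spaceW R :=
  ergodic_average (iterate q) (q ^ 2)%N.

End Instance.

(* Main.v *)
(* On the s-part, ADMM is Douglas-Rachford splitting for two lines at angle
   theta = 1/q: the variable y + x is multiplied by cos theta and rotated by
   -theta at every step.  As cos theta ^ (q^2) >= 1/2, the gap z - y, of length
   A0 * cos theta ^ k * sin theta, is still of order 1/q after K = q^2 steps,
   which bounds the residual of the last iterate.

   On the n-part, ADMM is the proximal point method z' + phi'(z') = z, whose
   steps have length at most mu = A0 / (4 q).  So z stays above A0 / 2 for about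
   2 q steps, and the average of z is at least 4 mu, in the region where phi' is
   nearly mu.  The multipliers x = phi'(z) are the successive decrements of z,
   so their average telescopes to at most A0 / q^2 <= mu / 4.  The z-component
   of the residual of the average is phi'(p) - x, with p a proximal point in
   that region, and is therefore at least mu / 2. *)

Require Import Defs.
From mathcomp Require Import all_boot all_order all_algebra.
From mathcomp Require Import all_classical all_reals all_analysis.
From mathcomp Require Import ring lra.
Import Order.TTheory GRing.Theory Num.Theory.
Import numFieldNormedType.Exports.
Local Open Scope ring_scope.

Set Implicit Arguments.
Unset Strict Implicit.

(** * Euclidean structure and proximal maps as minimizers *)

Lemma big_ord2 (T : nmodType) (F : 'I_2 -> T) : \sum_(i < 2) F i = F 0 + F 1.
Proof.
rewrite big_ord_recl big_ord1; congr (_ + F _); exact: val_inj.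
Qed.

Lemma dotHE (R : realType) (u v : spaceH R) :
  dotH u v = u.1 0 0 * v.1 0 0 + u.1 0 1 * v.1 0 1 + u.2 * v.2.
Proof. by rewrite /dotH big_ord2. Qed.

Lemma dotH_ge0 (R : realType) (u : spaceH R) : 0 <= dotH u u.
Proof. by rewrite dotHE -!expr2 !addr_ge0 ?sqr_ge0. Qed.

Lemma normH_sqr (R : realType) (u : spaceH R) : normH u ^+ 2 = dotH u u.
Proof. by rewrite sqr_sqrtr ?dotH_ge0. Qed.

Lemma rV2P (R : realType) (u v : 'rV[R]_2) :
  u 0 0 = v 0 0 -> u 0 1 = v 0 1 -> u = v.
Proof.
move=> h0 h1; apply/rowP => -[[|[|//]] i2].
  by rewrite (_ : Ordinal i2 = 0) //; apply: val_inj.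
by rewrite (_ : Ordinal i2 = 1) //; apply: val_inj.
Qed.

Lemma dotH_eq0 (R : realType) (u : spaceH R) : dotH u u = 0 -> u = 0.
Proof.
case: u => u t; rewrite dotHE /= -!expr2 => h.
have := sqr_ge0 (u 0 0); have := sqr_ge0 (u 0 1); have := sqr_ge0 t => ? ? ?.
have t0 : t = 0 by apply/eqP; rewrite -sqrf_eq0; apply/eqP; lra.
have u0 : u 0 0 = 0 by apply/eqP; rewrite -sqrf_eq0; apply/eqP; lra.
have u1 : u 0 1 = 0 by apply/eqP; rewrite -sqrf_eq0; apply/eqP; lra.
by congr pair => //; apply: rV2P; rewrite mxE.
Qed.

(** Quadratic growth, the strong convexity of proximal objectives, forces uniqueness as well as
    minimality, so [xget] has no other point to pick. *)
Lemma argmin_growth (R : realType) (F : spaceH R -> \bar R) (p : spaceH R)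
    (r : R) :
  F p = r%:E -> (forall v, ((r + 2^-1 * dotH (v - p) (v - p))%:E <= F v)%E) ->
  argmin F = p.
Proof.
move=> Fp growth; apply: xget_unique => [v|v vmin].
  rewrite Fp; apply: le_trans (growth v); rewrite lee_fin.
  by have := dotH_ge0 (v - p); lra.
have := le_trans (growth v) (vmin p); rewrite Fp lee_fin => le0.
have ge0 := dotH_ge0 (v - p).
by apply/eqP; rewrite -subr_eq0; apply/eqP/dotH_eq0; lra.
Qed.

Lemma argminD (R : realType) (F : spaceH R -> \bar R) (c : R) :
  argmin (fun v => F v + c%:E)%E = argmin F.
Proof.
congr (xget _ _); apply/predeqP => v; split => vmin u.
  by have := vmin u; rewrite leeD2rE.
by rewrite leeD2rE.
Qed.

(* Completing the square. *)
Lemma argmin_aug_z (R : realType) (F G : spaceH R -> \bar R) (x y : spaceH R)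
    (r : R) :
  F y = r%:E -> argmin (fun z => aug_lagrangian F G y z x) = prox G (y + x).
Proof.
move=> Fy; rewrite -[RHS](@argminD _ _ (r - 2^-1 * dotH x x)).
congr argmin; apply: funext => z; rewrite /aug_lagrangian Fy !normH_sqr.
rewrite [(r%:E + _)%E]addeC -!addeA -!EFinD; congr (_ + _%:E)%E.
rewrite !dotHE /= !mxE; by field.
Qed.

Lemma argmin_aug_y (R : realType) (F G : spaceH R -> \bar R) (x z : spaceH R)
    (r : R) :
  G z = r%:E -> argmin (fun y => aug_lagrangian F G y z x) = prox F (z - x).
Proof.
move=> Gz; rewrite -[RHS](@argminD _ _ (r - 2^-1 * dotH x x)).
congr argmin; apply: funext => y; rewrite /aug_lagrangian Gz !normH_sqr.
rewrite -!addeA -!EFinD; congr (_ + _%:E)%E.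
rewrite !dotHE /= !mxE; by field.
Qed.

(** * Proximal maps of [f] and [g] *)

Definition dir (R : realType) (q : nat) : 'rV[R]_2 :=
  vec2 (cos (theta R q)) (sin (theta R q)).

Definition normal (R : realType) (q : nat) : 'rV[R]_2 :=
  vec2 (- sin (theta R q)) (cos (theta R q)).

Definition dphi (R : realType) (q : nat) (t : R) : R :=
  mu R q * t / Num.sqrt (t ^+ 2 + eps R q ^+ 2).

Lemma vec2E0 (R : realType) (a b : R) : vec2 a b 0 0 = a.
Proof. by rewrite mxE. Qed.

Lemma vec2E1 (R : realType) (a b : R) : vec2 a b 0 1 = b.
Proof. by rewrite mxE. Qed.

Lemma sqr_cos (R : realType) (a : R) : cos a ^+ 2 = 1 - sin a ^+ 2.
Proof. by rewrite -(cos2Dsin2 a) addrK. Qed.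

Lemma prox_f (R : realType) (u : spaceH R) :
  prox (@f R) u = (u.1 0 0 *: e1 R, u.2).
Proof.
(* The minimum is half the squared distance from [u] to [U]; on [U] the growth bound is an equality,
   by Pythagoras. *)
apply: (@argmin_growth _ _ _ (2^-1 * u.1 0 1 ^+ 2)).
  rewrite /f /indicator/= memvZ ?memv_line// add0e normH_sqr dotHE/= !mxE/=.
  by congr EFin; by field.
move=> v; rewrite /f /indicator; case: ifPn => [|_]; last first.
  by rewrite addye ?leey.
move=> /vlineP[k vk]; rewrite add0e lee_fin normH_sqr !dotHE/= !mxE/= vk !mxE/=.
by rewrite -subr_ge0 [leRHS](_ : _ = 0)//; field.
Qed.

Lemma A0_gt0 (R : realType) : 0 < A0 R.
Proof. by rewrite invr_gt0 sqrtr_gt0. Qed.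

Lemma mu_gt0 (R : realType) (q : nat) : (0 < q)%N -> 0 < mu R q.
Proof. by move=> q0; rewrite divr_gt0 ?A0_gt0// mulr_gt0// ltr0n. Qed.

Lemma eps_gt0 (R : realType) (q : nat) : (0 < q)%N -> 0 < eps R q.
Proof. by move=> q0; rewrite divr_gt0 ?mu_gt0. Qed.

Lemma sqrt_eps_gt0 (R : realType) (q : nat) (t : R) :
  (0 < q)%N -> 0 < Num.sqrt (t ^+ 2 + eps R q ^+ 2).
Proof.
by move=> q0; rewrite sqrtr_gt0 ltr_wpDl ?sqr_ge0// exprn_gt0// eps_gt0.
Qed.

(* Cauchy-Schwarz for (p, eps) and (t, eps). *)
Lemma phi_tangent (R : realType) (q : nat) (p t : R) :
  (0 < q)%N -> phi q p + dphi q p * (t - p) <= phi q t.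
Proof.
move=> q0; have mu0 := mu_gt0 R q0; rewrite /phi /dphi.
have Sp0 := sqrt_eps_gt0 p q0; have St0 := sqrt_eps_gt0 t q0.
have Sp2 : Num.sqrt (p ^+ 2 + eps R q ^+ 2) ^+ 2 = p ^+ 2 + eps R q ^+ 2.
  by rewrite sqr_sqrtr// addr_ge0 ?sqr_ge0.
have St2 : Num.sqrt (t ^+ 2 + eps R q ^+ 2) ^+ 2 = t ^+ 2 + eps R q ^+ 2.
  by rewrite sqr_sqrtr// addr_ge0 ?sqr_ge0.
move: (Num.sqrt (p ^+ 2 + _)) (Num.sqrt (t ^+ 2 + _)) Sp0 St0 Sp2 St2.
move=> Sp St Sp0 St0 Sp2 St2.
have cauchy : eps R q ^+ 2 + p * t <= St * Sp.
  apply: le_trans (ler_norm _) _.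
  rewrite -(@ler_pXn2r _ 2) ?nnegrE ?mulr_ge0 ?(ltW Sp0) ?(ltW St0)//.
  rewrite real_normK ?num_real// [(St * Sp) ^+ 2]exprMn Sp2 St2 -subr_ge0.
  rewrite [X in 0 <= X](_ : _ = (eps R q * (t - p)) ^+ 2) ?sqr_ge0//; ring.
rewrite [leLHS](_ : _ = mu R q * (Sp + p * (t - p) / Sp)); last first.
  by field; rewrite gt_eqF.
rewrite ler_pM2l//.
rewrite -lerBrDl ler_pdivrMr//; nra.
Qed.

(** The objective separates: orthogonal projection onto the line [V] in the s-part, and in the
    n-part a stationarity equation that is sufficient by convexity of [phi]. *)
Lemma prox_g (R : realType) (q : nat) (u : spaceH R) (p : R) :
  (0 < q)%N -> p + dphi q p = u.2 ->
  prox (g q) u =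
    ((u.1 0 0 * cos (theta R q) + u.1 0 1 * sin (theta R q)) *: dir R q, p).
Proof.
move=> q0 pu; set c := cos _; set s := sin _; set a := _ + _.
(* [a] and [b] are the coordinates of [u.1] along [dir] and [normal]. *)
pose b := u.1 0 1 * c - u.1 0 0 * s.
have c2 : c ^+ 2 = 1 - s ^+ 2 by apply: sqr_cos.
apply: (@argmin_growth _ _ _ (phi q p + 2^-1 * (b ^+ 2 + (p - u.2) ^+ 2))).
  rewrite /g /indicator/= memvZ ?memv_line// add0e normH_sqr dotHE/= -EFinD.
  rewrite !mxE/= -/c -/s; congr (_ + _)%:E; rewrite /a /b; ring: c2.
move=> v; rewrite /g /indicator; case: ifPn => [|_]; last first.
  by rewrite !addye ?leey.
move=> /vlineP[k vk]; rewrite add0e -EFinD lee_fin normH_sqr !dotHE/=.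
rewrite !mxE/= vk !mxE/= -/c -/s.
have := phi_tangent p v.2 q0.
rewrite (_ : dphi q p = u.2 - p); last by rewrite -pu addrC addKr.
have split : (k * c - u.1 0 0) * (k * c - u.1 0 0) +
    (k * s - u.1 0 1) * (k * s - u.1 0 1) =
    b ^+ 2 + (k * c - a * c) ^+ 2 + (k * s - a * s) ^+ 2.
  rewrite /a /b; ring: c2.
nra.
Qed.

(** * The scalar proximal recursion of the n-part *)

Lemma dphi_ge0 (R : realType) (q : nat) (t : R) :
  (0 < q)%N -> 0 <= t -> 0 <= dphi q t.
Proof.
by move=> q0 t0; rewrite divr_ge0 ?sqrtr_ge0// mulr_ge0// ltW// mu_gt0.
Qed.

Lemma dphi_le (R : realType) (q : nat) (t : R) :
  (0 < q)%N -> dphi q t <= mu R q.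
Proof.
move=> q0; have mu0 := mu_gt0 R q0.
rewrite ler_pdivrMr ?sqrt_eps_gt0// ler_pM2l//.
by rewrite (le_trans (ler_norm t))// -sqrtr_sqr ler_wsqrtr// lerDl sqr_ge0.
Qed.

Lemma dphi_continuous (R : realType) (q : nat) :
  (0 < q)%N -> continuous (@dphi R q).
Proof.
move=> q0 t; apply: cvgM; first by apply: cvgM; [exact: cvg_cst|exact: cvg_id].
apply: cvgV; first by rewrite gt_eqF// sqrt_eps_gt0.
apply: (@continuous_comp _ _ _ (fun x : R => x ^+ 2 + eps R q ^+ 2) Num.sqrt).
  by apply: cvgD; [exact: exprn_continuous|exact: cvg_cst].
exact: sqrt_continuous.
Qed.

(** Intermediate value theorem on [0, u]: t + [dphi] t vanishes at 0 and is at least u at u. *)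
Lemma prox_phi_exists (R : realType) (q : nat) (u : R) :
  (0 < q)%N -> 0 <= u -> exists p, 0 <= p /\ p + dphi q p = u.
Proof.
move=> q0 u0; have dphi0 : dphi q 0 = 0 :> R by rewrite /dphi mulr0 mul0r.
have [||p] := @IVT R (fun t => t + dphi q t) 0 u u u0.
- apply: continuous_subspaceT => t; apply: cvgD; first exact: cvg_id.
  exact: dphi_continuous.
- by rewrite /= dphi0 addr0 ge_min le_max u0 lerDl dphi_ge0 ?orbT.
by rewrite in_itv => /andP[p0 _] pu; exists p.
Qed.

(** The resolvent of [dphi], that is, the scalar proximal map of [phi]; 0 is the default when no
    nonnegative solution exists. *)
Definition prox_phi (R : realType) (q : nat) (u : R) : R :=
  xget 0 [set p | 0 <= p /\ p + dphi q p = u]%classic.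

Lemma prox_phiP (R : realType) (q : nat) (u : R) :
  (0 < q)%N -> 0 <= u ->
  0 <= prox_phi q u /\ prox_phi q u + dphi q (prox_phi q u) = u.
Proof. by move=> q0 u0; exact: (xgetPex 0 (prox_phi_exists q0 u0)). Qed.

(* The n-part of the k-th iterate of z for k > 0, started from y_n^0 = A0
   instead of z_n^0 = 0. *)
Definition zn (R : realType) (q k : nat) : R := iter k (prox_phi q) (A0 R).

Arguments zn : simpl never.

Lemma zn_ge0 (R : realType) (q k : nat) : (0 < q)%N -> 0 <= zn R q k.
Proof.
move=> q0; elim: k => [|k IH]; first exact/ltW/A0_gt0.
by have [] := prox_phiP q0 IH.
Qed.

Lemma znS (R : realType) (q k : nat) :
  (0 < q)%N -> zn R q k.+1 + dphi q (zn R q k.+1) = zn R q k.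
Proof. by move=> q0; have [] := prox_phiP q0 (zn_ge0 R k q0). Qed.

Lemma zn_lb (R : realType) (q k : nat) :
  (0 < q)%N -> A0 R - k%:R * mu R q <= zn R q k.
Proof.
move=> q0; elim: k => [|k IH]; first by rewrite mul0r subr0.
have := znS R k q0; have := dphi_le (zn R q k.+1) q0.
rewrite -natr1 mulrDl mul1r; lra.
Qed.

(** * Closed form of the iterates *)

Definition amp (R : realType) (q k : nat) : R :=
  A0 R * cos (theta R q) ^+ k.

(** [amp] and [- ang] are the polar coordinates of the s-part of y + x after k steps. *)
Definition ang (R : realType) (q k : nat) : R := k%:R * theta R q.

Lemma angS (R : realType) (q k : nat) : ang R q k.+1 = ang R q k + theta R q.
Proof. by rewrite /ang -natr1 mulrDl mul1r. Qed.

(** The step sees y and x only through y + x: z' is the proximal point of [g] at y + x, x' is the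
    remainder y + x - z', and y' is the proximal point of [f] at z' - x'. Membership of y in [U]
    makes [f] finite there. *)
Lemma ADMM_stepE (R : realType) (q k : nat) (y z x : spaceH R) :
  (0 < q)%N -> y.1 \in U R ->
  y + x = (vec2 (amp R q k * cos (ang R q k)) (- amp R q k * sin (ang R q k)),
           zn R q k) ->
  ADMM_step (@f R) (g q) (y, z, x) =
    (((amp R q k * cos (ang R q k.+2)) *: e1 R,
      zn R q k.+1 - dphi q (zn R q k.+1)),
     ((amp R q k * cos (ang R q k.+1)) *: dir R q, zn R q k.+1),
     ((- amp R q k * sin (ang R q k.+1)) *: normal R q, dphi q (zn R q k.+1))).
Proof.
move=> q0 yU yx.
have fU (v : spaceH R) : v.1 \in U R -> f v = 0%:E.
  by rewrite /f /indicator => ->.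
have gV (v : spaceH R) : v.1 \in V R q -> g q v = (phi q v.2)%:E.
  by rewrite /g /indicator => ->; rewrite add0e.
rewrite /ADMM_step (argmin_aug_z _ _ (fU _ yU)) yx.
rewrite (@prox_g _ _ _ (zn R q k.+1))//; last exact: znS.
set z' := (_ *: dir R q, _).
have z'E : z' = ((amp R q k * cos (ang R q k.+1)) *: dir R q, zn R q k.+1).
  by congr (_ *: _, _); rewrite /= vec2E0 vec2E1 angS cosD; ring.
have z'V : z'.1 \in V R q by rewrite memvZ ?memv_line.
rewrite (argmin_aug_y _ _ (gV _ z'V)) z'E.
set x' := x + y - _.
have c2 := sqr_cos (theta R q).
have -> : x' = ((- amp R q k * sin (ang R q k.+1)) *: normal R q,
    dphi q (zn R q k.+1)).
  rewrite /x' [x + y]addrC yx; congr pair => /=; last first.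
    by apply/eqP; rewrite subr_eq addrC znS.
  apply: rV2P; rewrite !mxE/= angS cosD sinD; ring: c2.
rewrite prox_f; congr (_, _, _); congr (_ *: _, _).
(* In the s-part, z' - x' is the reflection of y + x in the line [V], so its angle is [ang] plus
   twice [theta]. *)
rewrite /= !mxE/= (angS _ _ k.+1) cosD; ring.
Qed.

(** The form of y + x is an invariant: it starts with length [A0] and angle 0, and each step
    reproduces it with k increased by one. *)
Lemma iterateS (R : realType) (q k : nat) : (0 < q)%N ->
  iterate R q k.+1 =
    (((amp R q k * cos (ang R q k.+2)) *: e1 R,
      zn R q k.+1 - dphi q (zn R q k.+1)),
     ((amp R q k * cos (ang R q k.+1)) *: dir R q, zn R q k.+1),
     ((- amp R q k * sin (ang R q k.+1)) *: normal R q, dphi q (zn R q k.+1))).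
Proof.
move=> q0; elim: k => [|k IH].
  rewrite /iterate /ADMM /= /w0; apply: (@ADMM_stepE R q 0 _ 0) => //=.
    exact: mem0v.
  congr pair; rewrite /= ?addr0// add0r; apply: rV2P; rewrite !mxE/= /amp /ang.
    by rewrite mul0r cos0 expr0; ring.
  by rewrite mul0r sin0; ring.
rewrite /iterate /ADMM iterS -/(ADMM _ _ _ _) -/(iterate R q k.+1) IH.
apply: ADMM_stepE => //=; first by rewrite memvZ ?memv_line.
have c2 := sqr_cos (theta R q).
congr pair; rewrite /= ?subrK//; apply: rV2P; rewrite !mxE/=.
  (* With a = [ang] at k + 1, cos (a + theta) + sin a sin theta = cos a cos theta yields the new
     factor cos theta of the amplitude. *)
  rewrite /amp exprSr (angS _ _ k.+1) cosD; ring: c2.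
rewrite /amp exprSr; ring.
Qed.

(** * Elementary trigonometric estimates *)

Lemma sin_MVT (R : realType) (x : R) : 0 <= x ->
  exists2 t, 0 <= t <= x & sin x = cos t * x.
Proof.
move=> x0; have [|t] := @MVT_segment R sin cos 0 x x0.
  exact/continuous_subspaceT/continuous_sin.
by rewrite in_itv/= sin0 !subr0 => tx ->; exists t.
Qed.

Lemma cos_ge (R : realType) (x : R) : 0 <= x -> 1 - x ^+ 2 / 2 <= cos x.
Proof.
move=> x0; have [|t _ sx] := @sin_MVT R (x / 2); first by rewrite divr_ge0.
(* Half angle: cos x = 1 - 2 sin (x/2)^2, and sin (x/2)^2 <= (x/2)^2 by the mean value theorem. *)
rewrite [in leRHS](_ : x = (x / 2) *+ 2); last by rewrite -mulr_natr; field.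
have t1 : cos t ^+ 2 <= 1 by rewrite sqr_cos gerBl sqr_ge0.
rewrite cos_mulr2n sqr_cos sx -mulr_natr; have := sqr_ge0 x; nra.
Qed.

Lemma sin_ge (R : realType) (x : R) : 0 <= x <= 1 -> x / 2 <= sin x.
Proof.
move=> /andP[x0 x1]; have [t /andP[t0 tx] ->] := sin_MVT x0.
have := cos_ge t0 => ct; rewrite mulrC ler_wpM2r//; nra.
Qed.

Lemma bernoulli_ineq (R : realType) (a : R) (n : nat) :
  0 <= a <= 1 -> 1 - n%:R * a <= (1 - a) ^+ n.
Proof.
move=> /andP[a0 a1]; elim: n => [|n IH]; first by rewrite mul0r subr0 expr0.
have n0 : 0 <= n%:R :> R by [].
rewrite exprSr -natr1; apply: (@le_trans _ _ ((1 - n%:R * a) * (1 - a))).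
  nra.
by rewrite ler_wpM2r// subr_ge0.
Qed.

(** * Norms, normalization and bounds at the angle theta *)

Lemma A0_sqr (R : realType) : A0 R ^+ 2 = 2^-1.
Proof. by rewrite exprVn sqr_sqrtr. Qed.

Lemma normW_ge_zn (R : realType) (w : spaceW R) : `|w.1.2.2| <= normW w.
Proof.
rewrite -sqrtr_sqr ler_wsqrtr// !normH_sqr.
have := dotH_ge0 w.1.1; have := dotH_ge0 w.2; rewrite (dotHE w.1.2).
have := sqr_ge0 (w.1.2.1 0 0); have := sqr_ge0 (w.1.2.1 0 1); lra.
Qed.

Lemma normW_ge_gap (R : realType) (w : spaceW R) : normH w.2 <= normW w.
Proof. by rewrite ler_wsqrtr// !normH_sqr lerDr addr_ge0 ?dotH_ge0. Qed.

Lemma R0E (R : realType) : R0 R = 1.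
Proof.
rewrite /R0 /wstar subr0 /normW !normH_sqr !dotHE /= !mxE/=.
rewrite -[RHS]sqrtr1; congr Num.sqrt; have := A0_sqr R; lra.
Qed.

(** As sqrt (2 q^2) = q sqrt 2, the target bounds are multiples of [mu]: [mu] itself for a = 4 and
    half of it for a = 8. *)
Lemma boundE (R : realType) (q : nat) (a : R) : (0 < q)%N -> a != 0 ->
  R0 R / (a * Num.sqrt (2 * (q ^ 2)%N%:R)) = 4 / a * mu R q.
Proof.
move=> q0 a0; have qn0 : q%:R != 0 :> R by rewrite pnatr_eq0 -lt0n.
have s0 : Num.sqrt 2 != 0 :> R by rewrite gt_eqF// sqrtr_gt0.
rewrite R0E sqrtrM// natrX sqrtr_sqr ger0_norm// /mu /A0; field.
by rewrite a0 qn0 s0.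
Qed.

Lemma theta_itv (R : realType) (q : nat) : (0 < q)%N -> 0 <= theta R q <= 1.
Proof.
by move=> q0; rewrite invr_ge0 ler0n/= invf_le1 ?ltr0n// ler1n.
Qed.

Lemma sin_theta_ge (R : realType) (q : nat) : (0 < q)%N ->
  theta R q / 2 <= sin (theta R q).
Proof. by move=> q0; apply/sin_ge/theta_itv. Qed.

Lemma sin_theta_gt0 (R : realType) (q : nat) : (0 < q)%N ->
  0 < sin (theta R q).
Proof.
move=> q0; apply: lt_le_trans (sin_theta_ge R q0).
by rewrite divr_gt0// invr_gt0 ltr0n.
Qed.

(** By Bernoulli, (1 - theta^2 / 2)^k >= 1 - k theta^2 / 2, and k theta^2 <= 1. *)
Lemma cos_theta_exp (R : realType) (q k : nat) : (0 < q)%N -> (k <= q ^ 2)%N ->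
  2^-1 <= cos (theta R q) ^+ k.
Proof.
move=> q0 kq; have /andP[th0 th1] := theta_itv R q0.
have a01 : 0 <= theta R q ^+ 2 / 2 <= 1 by apply/andP; split; nra.
have a1 : 0 <= 1 - theta R q ^+ 2 / 2 by case/andP: a01; lra.
apply: le_trans (_ : (1 - theta R q ^+ 2 / 2) ^+ k <= _).
  apply: le_trans (bernoulli_ineq k a01).
  have : k%:R * theta R q ^+ 2 <= 1.
    rewrite exprVn ler_pdivrMr ?exprn_gt0 ?ltr0n// mul1r -natrX ler_nat//.
  lra.
by rewrite lerXn2r ?nnegrE ?(le_trans a1)// cos_ge.
Qed.

(** * Residual of the last iterate *)

Lemma last_iterate_residual (R : realType) (q : nat) : (0 < q)%N ->
  mu R q <= normW (residual q (last_iterate R q)).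
Proof.
move=> q0; have K0 : (0 < q ^ 2)%N by rewrite expn_gt0 q0.
have kK : ((q ^ 2).-1 <= q ^ 2)%N by exact: leq_pred.
(* The closed form describes successors, so K is written k + 1 and the amplitude carries the
   exponent K - 1. *)
rewrite /last_iterate -(prednK K0); move: (q ^ 2).-1 kK => k kK.
rewrite iterateS//; apply: le_trans (normW_ge_gap _) => /=.
have s0 := sin_theta_ge R q0; have ck := cos_theta_exp R q0 kK.
have qn0 : 0 < q%:R :> R by rewrite ltr0n.
(* The factors 1/2 for the cosine power and theta / 2 for the sine multiply to [A0] / (4 q) =
   [mu]. *)
apply: (@le_trans _ _ (amp R q k * sin (theta R q))).
  rewrite /mu /amp -mulrA ler_pM2l ?A0_gt0// invfM -/(theta R q).
  have /andP[th0 _] := theta_itv R q0; nra.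
apply: le_trans (ler_norm _) _; rewrite -sqrtr_sqr ler_wsqrtr//.
rewrite dotHE /= !mxE/= (angS _ _ k.+1) cosD.
have c2 := sqr_cos (ang R q k.+1).
set n2 := dphi _ _.
(* With a = [ang] at k + 1, the s-part of z - y is amp sin theta times the unit vector (sin a, cos
   a); its n-part is [n2]. *)
rewrite [leRHS](_ : _ = (amp R q k * sin (theta R q)) ^+ 2 + n2 ^+ 2).
  by rewrite lerDl sqr_ge0.
ring: c2.
Qed.

(** * Residual of the ergodic average *)

Lemma dphi_ge (R : realType) (q : nat) (t : R) : (0 < q)%N ->
  mu R q <= 5 * t -> 3 / 4 * mu R q <= dphi q t.
Proof.
move=> q0 tge; have mu0 := mu_gt0 R q0.
have t0 : 0 < t by lra.
have epsE : eps R q = mu R q / 10 by [].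
(* The hypothesis says t >= 2 eps, so the root is at most sqrt 5 / 2 times t, which is below 4/3
   t. *)
have sqrt_le : Num.sqrt (t ^+ 2 + eps R q ^+ 2) <= 4 / 3 * t.
  rewrite -[leRHS]ger0_norm; last by rewrite mulr_ge0// ltW.
  by rewrite -sqrtr_sqr ler_wsqrtr// epsE; nra.
rewrite /dphi ler_pdivlMr ?sqrt_eps_gt0//; nra.
Qed.

Lemma averageE (R : realType) (q : nat) (h : spaceW R -> R) :
  h 0 = 0 -> {morph h : u v / u + v} ->
  (forall a, {morph h : u / a *: u >-> a * u}) ->
  h (average R q) =
    (q ^ 2)%N%:R^-1 * \sum_(1 <= j < (q ^ 2).+1) h (iterate R q j).
Proof. by move=> h0 hD hZ; rewrite hZ (big_morph h hD h0). Qed.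

Lemma average_xn (R : realType) (q : nat) : (0 < q)%N ->
  (average R q).2.2 = (q ^ 2)%N%:R^-1 * (A0 R - zn R q (q ^ 2)).
Proof.
move=> q0; rewrite (@averageE R q (fun w => w.2.2))//; congr (_ * _).
transitivity (\sum_(0 <= j < q ^ 2) (- zn R q j.+1 - - zn R q j)).
  rewrite big_add1; apply: eq_bigr => j _.
  by rewrite iterateS// opprK; apply: canRL (addKr _) (znS R j q0).
by rewrite (@telescope_sumr _ 0 _ (fun j => - zn R q j))//= opprK addrC.
Qed.

Lemma average_zn (R : realType) (q : nat) : (0 < q)%N ->
  (average R q).1.2.2 =
    (q ^ 2)%N%:R^-1 * \sum_(0 <= j < q ^ 2) zn R q j.+1.
Proof.
move=> q0; rewrite (@averageE R q (fun w => w.1.2.2))//; congr (_ * _).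
by rewrite big_add1; apply: eq_bigr => j _; rewrite iterateS.
Qed.

Lemma A0E (R : realType) (q : nat) : (0 < q)%N -> A0 R = 4 * q%:R * mu R q.
Proof. by move=> q0; rewrite /mu; field; rewrite pnatr_eq0 -lt0n. Qed.

(** Only the first 2 q of the q^2 terms are kept, which fit since q >= 2: each is at least 4 q mu -
    2 q mu = 2 q mu. *)
Lemma average_zn_ge (R : realType) (q : nat) : (2 <= q)%N ->
  4 * mu R q <= (average R q).1.2.2.
Proof.
move=> q2; have q0 : (0 < q)%N by exact: ltnW.
have q0R : 0 < q%:R :> R by rewrite ltr0n.
have mu0 := mu_gt0 R q0.
rewrite average_zn// natrX ler_pdivlMl ?exprn_gt0//.
have le2 : (2 * q <= q ^ 2)%N by rewrite expnS expn1 leq_mul2r q2 orbT.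
rewrite (@big_cat_nat _ _ _ (2 * q))//=.
rewrite -[leLHS]addr0; apply: lerD; last first.
  by apply: sumr_ge0 => j _; exact: zn_ge0.
apply: (@le_trans _ _ (\sum_(0 <= j < 2 * q) 2 * q%:R * mu R q)).
  rewrite sumr_const_nat subn0 -[leRHS]mulr_natl natrM expr2; lra.
rewrite !big_nat ler_sum// => j /andP[_ jq].
apply: le_trans (zn_lb R j.+1 q0); rewrite (A0E R q0).
have : j.+1%:R <= 2 * q%:R :> R by rewrite -natrM ler_nat.
nra.
Qed.

Lemma average_residual (R : realType) (q : nat) : (16 <= q)%N ->
  2^-1 * mu R q <= normW (residual q (average R q)).
Proof.
move=> q16; have q0 : (0 < q)%N by exact: leq_trans q16.
have mu0 := mu_gt0 R q0.
have zge : 4 * mu R q <= (average R q).1.2.2.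
  by apply: average_zn_ge; exact: leq_trans q16.
have K0 : 0 < (q ^ 2)%N%:R :> R by rewrite ltr0n expn_gt0 q0.
have q16R : 16 <= q%:R :> R by rewrite ler_nat.
(* The average is at most [A0] / q^2 = 4 mu / q; here q >= 16 gives mu / 4. *)
have xle : (average R q).2.2 <= mu R q / 4.
  rewrite average_xn// ler_pdivrMl//.
  have : 0 <= mu R q * (q%:R * (q%:R - 16)).
    by rewrite mulr_ge0 ?(ltW mu0)// mulr_ge0// subr_ge0.
  have := zn_ge0 R (q ^ 2) q0; rewrite (A0E R q0) natrX expr2; lra.
have xge : 0 <= (average R q).2.2.
  rewrite average_xn// mulr_ge0 ?invr_ge0 ?(ltW K0)// subr_ge0.
  elim: (q ^ 2)%N => [//|k IH]; apply: le_trans IH.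
  by rewrite -(znS R k q0) lerDl dphi_ge0// zn_ge0.
apply: le_trans (normW_ge_zn _).
move: (average R q) zge xle xge => [[y z] x] /= zge xle xge.
have u0 : 0 <= (z + x).2 by rewrite /=; lra.
have [p0 pE] := prox_phiP q0 u0.
rewrite (prox_g q0 pE) /=; move: (prox_phi q _) p0 pE => p p0 pE.
have ple := dphi_le p q0; rewrite /= in pE.
(* Here p = z + x - [dphi] p >= 4 mu - mu, far above mu / 5. The residual z - p = [dphi] p - x is
   then at least 3/4 mu - 1/4 mu. *)
have pge : 3 / 4 * mu R q <= dphi q p by apply: dphi_ge => //; lra.
by apply: le_trans (ler_norm _); lra.
Qed.

(** * The KKT point *)

Lemma is_KKT_zero (R : realType) (q : nat) :
  (0 < q)%N -> is_KKT (@f R) (g q) (wstar R).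
Proof.
move=> q0.
have f0 : f (0 : spaceH R) = 0%E by rewrite /f /indicator mem0v.
have g0 : g q (0 : spaceH R) = (phi q 0)%:E.
  by rewrite /g /indicator mem0v add0e.
have dot0 (v : spaceH R) : dotH 0 v = 0.
  by rewrite dotHE /= !mxE !mul0r !addr0.
split; last by rewrite subrr.
- exists 0; last by rewrite addr0.
  by move=> u; rewrite f0 dot0 adde0 /f /indicator; case: ifP.
exists 0; last by rewrite subr0.
move=> u; rewrite g0 dot0 adde0 /g /indicator; case: ifP => _; last first.
  by rewrite addye ?leey.
have := phi_tangent 0 u.2 q0; rewrite /dphi mulr0 !mul0r addr0 add0e.
by rewrite lee_fin.
Qed.

(** The lines [U] and [V] meet only at 0, which kills the s-part of y. The s-part of x is orthogonal
    to both lines, hence 0; its n-part vanishes because [f] is constant there, and then y.2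
    minimizes [phi]. *)
Lemma is_KKT_unique (R : realType) (q : nat) (w : spaceW R) :
  (0 < q)%N -> is_KKT (@f R) (g q) w -> w = wstar R.
Proof.
move=> q0; case: w => [[y z] x] [[a fa /eqP ax] [b gb /eqP bx] /eqP].
rewrite subr_eq0 => /eqP yz; subst z.
move: ax bx; rewrite addr_eq0 subr_eq0 => /eqP ? /eqP ?; subst a b.
have s0 := sin_theta_gt0 R q0.
have yU : y.1 \in U R.
  apply: contraPT (fa 0) => yU; rewrite /f /indicator mem0v.
  by rewrite (negbTE yU) addye.
have yV : y.1 \in V R q.
  apply: contraPT (gb 0) => yV; rewrite /g /indicator mem0v.
  by rewrite (negbTE yV) !addye.
have f0 v : v.1 \in U R -> 0 <= dotH x (v - y).
  move=> vU; have := fa v; rewrite /f /indicator yU vU add0e lee_fin.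
  by rewrite !dotHE /= !mxE; lra.
have g0 v : v.1 \in V R q -> phi q y.2 + dotH x (v - y) <= phi q v.2.
  move=> vV; have := gb v; rewrite /g /indicator yV vV !add0e.
  by rewrite -EFinD lee_fin.
have y1 : y.1 = 0.
  have /vlineP[k yk] := yU; have /vlineP[l yl] := yV.
  move: yk; rewrite yl => /rowP/(_ 1); rewrite !mxE/= mulr0 => /eqP.
  by rewrite mulf_eq0 (gt_eqF s0) orbF => /eqP ->; rewrite scale0r.
have eU := memv_line (e1 R); have dV := memv_line (dir R q).
have xn : x.2 = 0.
  (* This test point turns the subgradient inequality into 0 <= - x.2^2. *)
  have := f0 (0, y.2 - x.2) (mem0v _); rewrite dotHE /= y1 !mxE => h.
  by apply/eqP; rewrite -sqrf_eq0 eq_le sqr_ge0 andbT; nra.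
have x0 : x.1 0 0 = 0.
  have := f0 (e1 R, y.2) eU; have := f0 (- e1 R, y.2); rewrite memvN => /(_ eU).
  rewrite !dotHE /= y1 !mxE/=; lra.
have x1 : x.1 0 1 = 0.
  (* Keeping the n-part y.2 cancels [phi], and the two signs force orthogonality to [dir]. *)
  have := g0 (dir R q, y.2) dV; have := g0 (- dir R q, y.2).
  rewrite memvN => /(_ dV); rewrite !dotHE /= y1 !mxE/= x0 => h1 h2.
  have : x.1 0 1 * sin (theta R q) = 0 by lra.
  by move/eqP; rewrite mulf_eq0 (gt_eqF s0) orbF => /eqP.
have y2 : y.2 = 0.
  have := g0 (0, 0) (mem0v _); rewrite dotHE /= x0 x1 xn !mul0r !addr0.
  rewrite /phi ler_pM2l ?mu_gt0// => h; apply/eqP; rewrite -sqrf_eq0 eq_le.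
  rewrite sqr_ge0 andbT -(lerD2r (eps R q ^+ 2)); move: h.
  by rewrite ler_psqrt ?nnegrE ?addr_ge0 ?sqr_ge0// expr0n.
have -> : y = 0 by case: y y1 y2 {yU yV f0 g0 fa gb} => ? ? /= -> ->.
have -> // : x = 0.
case: x x0 x1 xn {yU yV f0 g0 fa gb} => x1 x2 /= h0 h1 ->.
by congr pair; apply: rV2P; rewrite mxE.
Qed.

(** * Failure of the rate 1/K *)

Lemma no_uniform_rate (R : realType) (c : R) (F : nat -> R) : 0 < c ->
  (forall q, (16 <= q)%N -> c * mu R q <= F q) ->
  ~ exists2 C : R, 0 < C &
      forall q, (16 <= q)%N -> F q <= C * R0 R / (q ^ 2)%N%:R.
Proof.
move=> c0 lb [C C0 ub].
have B0 : 0 <= 4 * C / (c * A0 R).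
  by rewrite divr_ge0 ?mulr_ge0 ?(ltW C0) ?(ltW c0) ?(ltW (A0_gt0 R)).
(* Multiplied by q^2, the two bounds give c A0 q / 4 <= C, which fails at q = N + 16 by the
   Archimedean property. *)
set N := Num.bound (4 * C / (c * A0 R)).
have q16 : (16 <= N + 16)%N by rewrite leq_addl.
have q0 : 0 < (N + 16)%:R :> R by rewrite ltr0n addnS.
have := le_trans (lb _ q16) (ub _ q16); rewrite R0E mulr1 natrX.
rewrite ler_pdivlMr ?exprn_gt0//.
rewrite [leLHS](_ : _ = c * A0 R * (N + 16)%:R / 4); last first.
  by rewrite /mu; field; rewrite gt_eqF.
rewrite ler_pdivrMr// -ler_pdivlMl ?mulr_gt0 ?A0_gt0// => leN.
have := archi_boundP B0; rewrite -/N ltNge => /negP; apply.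
rewrite mulrC (mulrC 4); apply: le_trans leN; rewrite ler_nat leq_addr//.
Qed.

Theorem theorem1 (R : realType) :
  (forall q : nat, (16 <= q)%N ->
     let K : R := (q ^ 2)%N%:R in
     [/\ forall w : spaceW R, is_KKT (@f R) (g q) w <-> w = wstar R,
         R0 R / (4 * Num.sqrt (2 * K)) <= normW (residual q (last_iterate R q))
       & R0 R / (8 * Num.sqrt (2 * K)) <= normW (residual q (average R q))]) /\
  (~ exists2 C : R, 0 < C &
       forall q : nat, (16 <= q)%N ->
         normW (residual q (last_iterate R q)) <= C * R0 R / (q ^ 2)%N%:R) /\
  (~ exists2 C : R, 0 < C &
       forall q : nat, (16 <= q)%N ->
         normW (residual q (average R q)) <= C * R0 R / (q ^ 2)%N%:R).
Proof.
have q_gt0 q : (16 <= q)%N -> (0 < q)%N by exact: leq_trans.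
split; last split.
- move=> q q16 K; have q0 := q_gt0 q q16; split.
  + by move=> w; split => [|->]; [exact: is_KKT_unique|exact: is_KKT_zero].
  + by rewrite boundE// divff// mul1r last_iterate_residual.
  + rewrite boundE// (_ : 4 / 8 = 2^-1 :> R); last by field.
    exact: average_residual.
- apply: (no_uniform_rate ltr01) => q /q_gt0 q0.
  by rewrite mul1r last_iterate_residual.
- apply: (@no_uniform_rate R 2^-1); first by rewrite invr_gt0.
  by move=> q; exact: average_residual.
Qed.
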